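(* Let $N,L$ be positive integers. There is a constant $C_L>0$ depending only on $L$ such that for any $\epsilon>0$ and any subset $X\subset\mathbb{T}^N$ of cardinality at least $C_L\,\epsilon^{-3LN}$ there exists a matrix $T\in\mathrm{M}_{L\times N}(\mathbb{Z})$ whose entries are relatively prime such that $TX$ is $\epsilon$-dense in $\mathbb{T}^L$.
   Context: $\mathbb{T}=\mathbb{R}/\mathbb{Z}$; $T$ acts on $\mathbb{T}^N$ by left multiplication. A subset of $\mathbb{T}^L$ is $\epsilon$-dense in $\mathbb{T}^L$ if it intersects every box of side length $2\epsilon$.
   Formalization: For L = N = 1 the matrix T is not claimed to have relatively prime entries (only that TX is ε-dense), since T = (±1) would make the claim false when X is a short arc. *)

(* Defs.v *)
From HB Require Import structures.
From mathcomp Require Import all_boot all_order all_algebra.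
From mathcomp Require Import ring_quotient.
From mathcomp Require Import all_classical all_reals.

Set Implicit Arguments.
Unset Strict Implicit.
Unset Printing Implicit Defensive.

Import Order.TTheory GRing.Theory Num.Theory.

Local Open Scope classical_set_scope.
Local Open Scope quotient_scope.
Local Open Scope ring_scope.

Definition Zsubgroup (R : realType) : zmodClosed R :=
  GRing.ZmodClosed.clone R (@Num.int_num_subdef R) _.

(* The additive group R/Z; points of T^n are column vectors 'cV[torus R]_n. *)
Notation torus R := (Quotient.quot (Zsubgroup R)).

Definition torus_pi (R : realType) (t : R) : torus R := \pi_(torus R) t.

(* `*m` is not available since the torus is only a Z-module. *)
Definition torus_mulmx (R : realType) (L N : nat) (T : 'M[int]_(L, N))
    (x : 'cV[torus R]_N) : 'cV[torus R]_L :=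
  \col_i \sum_j x j 0 *~ T i j.

(* The image in the torus of a product of bounded intervals of length [s],
   each interval being closed or open at either endpoint. *)
Definition torus_box (R : realType) (L : nat) (s : R) (B : set 'cV[torus R]_L) :
    Prop :=
  exists (a : 'I_L -> R) (b1 b2 : 'I_L -> bool),
    B = [set y | forall i, exists2 t : R,
           t \in Interval (BSide (b1 i) (a i)) (BSide (b2 i) (a i + s))
           & y i 0 = torus_pi t].

Definition eps_dense (R : realType) (L : nat) (eps : R)
    (Y : set 'cV[torus R]_L) : Prop :=
  forall B, torus_box (2%:R * eps) B -> Y `&` B !=set0.

(* [X] is possibly infinite and [r] need not be an integer. *)
Definition card_at_least (R : realType) (U : Type) (X : set U) (r : R) : Prop :=
  exists2 n : nat, r <= n%:R & (`I_n #<= X)%card.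

Definition relatively_prime_entries (L N : nat) (T : 'M[int]_(L, N)) : Prop :=
  \big[gcdn/0%N]_(i < L) \big[gcdn/0%N]_(j < N) `|T i j|%N = 1%N.

(* Main.v *)
Require Import Defs.
From mathcomp Require Import all_boot all_order all_algebra.
From mathcomp Require Import ring lra zify.
From mathcomp Require Import ring_quotient complex.
From mathcomp Require Import all_classical all_reals trigo.

(* Second moment method.  For points y_1, ..., y_k of T^L and a frequency m put
   W_m = sum_i e(m . y_i).  Let p be the square of the Dirichlet sum
   1 + e(t) + ... + e((h-1)t), with h of order L / eps, and F the product over the
   coordinates of |p|^2.  If all the y_i avoid a box of side 2 eps centred at 0, then
   each y_i has a coordinate t where |1 - e(t)|^2 >= 8 eps^2, and replacing |p|^2 by
   |(1 - e) p|^2 / (8 eps^2) in that coordinate does not decrease F.  As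
   (1 - e) p has coefficients 1 and -1 only, the new kernels have a much smaller
   mean than F, so the W_m with 0 < |m| <= 2h must be large: the sum of the |W_m|^2
   is at least k^2 / (9 (4h)^L).  On the other hand, for y_i = T x_i with the
   entries of T uniform in {1, ..., H} and H large, the mean of |W_m|^2 is about
   the number of pairs (i, i') with m_l (x_i - x_i') = 0 for all l, which is at
   most k (2h)^N.  So less than a quarter of the T fail; at least a quarter of them
   have two coprime entries when L N > 1, because the sum of 1 / d^2 over d >= 2 is at
   most 3/4. *)

Set Implicit Arguments.
Unset Strict Implicit.
Unset Printing Implicit Defensive.

Import Order.TTheory GRing.Theory Num.Theory.
Import ComplexField.Normc.

Local Open Scope ring_scope.

(** * Inequalities for finite sums *)

Lemma ler_sum_inj (R : numDomainType) (I K : finType) (P : pred I) (Q : pred K)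
    (h : I -> K) (F : K -> R) :
  injective h -> (forall i, P i -> Q (h i)) -> (forall j, 0 <= F j) ->
  \sum_(i | P i) F (h i) <= \sum_(j | Q j) F j.
Proof.
move=> h_inj PQ F0.
rewrite [leRHS](bigID (mem [set h i | i in P])) /=.
rewrite (eq_bigl (mem [set h i | i in P])); last first.
  by move=> j /=; apply/andb_idl => /finset.imsetP[i Pi ->]; exact: PQ.
by rewrite big_imset /=; [rewrite lerDl sumr_ge0 | move=> ? ? _ _; exact: h_inj].
Qed.

(** Cauchy-Schwarz against the constant 1: expand the nonnegative double sum of
    [(a i - a j) ^+ 2]. *)
Lemma sqr_sum_le (R : realFieldType) (I : finType) (P : pred I) (a : I -> R) :
  (\sum_(i | P i) a i) ^+ 2 <= #|P|%:R * \sum_(i | P i) a i ^+ 2.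
Proof.
have: 0 <= \sum_(i | P i) \sum_(j | P j) (a i - a j) ^+ 2.
  by apply: sumr_ge0 => i _; apply: sumr_ge0 => j _; exact: sqr_ge0.
under eq_bigr => i _ do under eq_bigr => j _ do rewrite sqrrB.
under eq_bigr => i _ do rewrite big_split sumrB /= sumr_const sumrMnl -mulr_sumr.
rewrite big_split sumrB /= sumr_const !sumrMnl -mulr_suml.
set s := \sum_(i | P i) a i; set t := \sum_(i | P i) a i ^+ 2.
by rewrite -(mulr_natl t) expr2 => ?; nra.
Qed.

(** Since 2 a_i a_j <= a_i^2 + a_j^2, the first square meets a row sum of [W] and the second a
    column sum. *)
Lemma schur_test (R : realFieldType) (I : finType) (a : I -> R) (W : I -> I -> R)
    (S : R) :
  (forall i j, 0 <= W i j) ->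
  (forall i, \sum_(j | j != i) W i j <= S) ->
  (forall i, \sum_(j | j != i) W j i <= S) ->
  \sum_i \sum_(j | j != i) a i * a j * W i j <= (\sum_i a i ^+ 2) * S.
Proof.
move=> W0 rowS colS.
pose b i := a i ^+ 2 / 2.
have b0 i : 0 <= b i by rewrite divr_ge0 ?sqr_ge0.
apply: (@le_trans _ _ (\sum_i \sum_(j | j != i) (b i * W i j + b j * W i j))).
  apply: ler_sum => i _; apply: ler_sum => j _; rewrite -mulrDl.
  apply: ler_wpM2r => //; have := sqr_ge0 (a i - a j); rewrite /b; nra.
under eq_bigr => i _ do rewrite big_split /=.
rewrite big_split /= [X in _ + X](exchange_big_dep predT) //= -big_split mulr_suml.
apply: ler_sum => i _; rewrite -!mulr_sumr.
have colS' : \sum_(j | i != j) W j i <= S.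
  by under eq_bigl => j do rewrite eq_sym.
have -> : a i ^+ 2 * S = b i * S + b i * S by rewrite /b; field.
by apply: lerD; apply: ler_wpM2l.
Qed.

(** * The complex modulus *)

Section Normc.
Variable R : rcfType.
Implicit Types z : R[i].

Lemma normc_ge0 z : 0 <= normc z.
Proof. by case: z => a b; exact: sqrtr_ge0. Qed.

Lemma normc_real (a : R) : normc (a%:C%C) = `|a|.
Proof. by rewrite /normc /= expr0n addr0 sqrtr_sqr. Qed.

Lemma sqr_normcE z : ((normc z) ^+ 2)%:C%C = z * conjc z.
Proof.
case: z => a b; rewrite sqr_sqrtr ?addr_ge0 ?sqr_ge0 //; simpc.
by congr Complex; ring.
Qed.

Lemma normc_conj z : normc (conjc z) = normc z.
Proof. by case: z => a b; rewrite /= sqrrN. Qed.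

Lemma conjc_normc1 z : normc z = 1 -> conjc z = z^-1.
Proof.
move=> z1; have z0 : z != 0 by apply/eqP => z0; move: z1; rewrite z0 normc0; lra.
by apply: (mulfI z0); rewrite -sqr_normcE z1 expr1n divff.
Qed.

Lemma normcX z m : normc (z ^+ m) = normc z ^+ m.
Proof. by elim: m => [|m IH]; rewrite ?normc1 // !exprS normcM IH. Qed.

Lemma normcXz z (m : int) : normc (z ^ m) = normc z ^ m.
Proof. by case: m => m; rewrite ?NegzE -?exprnN ?normcV -?exprnP ?normcX. Qed.

Lemma normcB z1 z2 : normc (z1 - z2) = normc (z2 - z1).
Proof. by rewrite -opprB normcN. Qed.

Lemma normc_sum (I : Type) (r : seq I) (P : pred I) (F : I -> R[i]) :
  normc (\sum_(i <- r | P i) F i) <= \sum_(i <- r | P i) normc (F i).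
Proof.
elim/big_ind2: _ => [|a b c d H1 H2|//]; first by rewrite normc0.
by apply: le_trans (le_normcD _ _) _; exact: lerD.
Qed.

Lemma normc_prod (I : Type) (r : seq I) (P : pred I) (F : I -> R[i]) :
  normc (\prod_(i <- r | P i) F i) = \prod_(i <- r | P i) normc (F i).
Proof. by elim/big_rec2: _ => [|i y1 y2 _ <-]; rewrite ?normc1 ?normcM. Qed.

Lemma normc1_neq0 z : normc z = 1 -> z != 0.
Proof. by move=> z1; apply/eqP => z0; move: z1; rewrite z0 normc0; lra. Qed.

End Normc.

(** * Exponential sums and product kernels *)

Section ExpSum.
Variables (R : rcfType) (L k : nat) (v : 'I_k -> 'I_L -> R[i]).
Hypothesis v_norm : forall i l, normc (v i l) = 1.

Definition exp_sum (m : 'I_L -> int) : R[i] := \sum_i \prod_l v i l ^ m l.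

(** The shift by [n] makes the cube [-n, n)^L a finite type; it contains all differences of
    exponents below [n]. *)
Definition freq n (d : {ffun 'I_L -> 'I_(n + n)}) (l : 'I_L) : int :=
  (d l)%:Z - n%:Z.

Definition freq_nz n (d : {ffun 'I_L -> 'I_(n + n)}) : bool :=
  [exists l, freq d l != 0].

Definition exp_sum_l1 n : R := \sum_(d | @freq_nz n d) normc (exp_sum (freq d)).

(** By Parseval, the mean of |p|^2 over the unit circle when [size p <= n]. *)
Definition coef_energy n (p : {poly R[i]}) : R := \sum_(j < n) normc p`_j ^+ 2.

Lemma exp_sum_l1_ge0 n : 0 <= exp_sum_l1 n.
Proof. by apply: sumr_ge0 => j _; exact: normc_ge0. Qed.

Lemma diff_freq_subproof n (a b : 'I_n) : (a + n - b < n + n)%N.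
Proof. have := ltn_ord a; have := ltn_ord b; lia. Qed.

Definition diff_freq n (J K : {ffun 'I_L -> 'I_n}) : {ffun 'I_L -> 'I_(n + n)} :=
  [ffun l => Ordinal (diff_freq_subproof (J l) (K l))].

Lemma freq_diff n (J K : {ffun 'I_L -> 'I_n}) l :
  freq (diff_freq J K) l = (J l)%:Z - (K l)%:Z.
Proof. by rewrite /freq ffunE /=; have := ltn_ord (K l); lia. Qed.

Lemma diff_freq_nz n (J K : {ffun 'I_L -> 'I_n}) :
  J != K -> freq_nz (diff_freq J K).
Proof.
apply: contraNT => /existsPn H; apply/eqP/ffunP => l; apply/val_inj.
by move: (H l); rewrite negbK freq_diff /=; lia.
Qed.

(** With one index fixed no frequency repeats, so each row and column of the matrix in Schur's test
    sums to at most [exp_sum_l1]. *)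
Lemma diff_freq_injl n (K : {ffun 'I_L -> 'I_n}) : injective (fun J => diff_freq J K).
Proof.
move=> J J' /(congr1 (@freq n)) E; apply/ffunP => l; apply/val_inj.
by have := congr1 (@^~ l) E; rewrite !freq_diff /=; lia.
Qed.

Lemma diff_freq_injr n (J : {ffun 'I_L -> 'I_n}) : injective (diff_freq J).
Proof.
move=> K K' /(congr1 (@freq n)) E; apply/ffunP => l; apply/val_inj.
by have := congr1 (@^~ l) E; rewrite !freq_diff /=; lia.
Qed.

Section Kernel.
Variables (n : nat) (Q : 'I_L -> {poly R[i]}).
Hypothesis Q_size : forall l, (size (Q l) <= n)%N.

Let w (J : {ffun 'I_L -> 'I_n}) : R[i] := \prod_l (Q l)`_(J l).

Lemma prod_horner i :
  \prod_l (Q l).[v i l] = \sum_J w J * \prod_l v i l ^+ J l.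
Proof.
under eq_bigr => l _ do rewrite (horner_coef_wide _ (Q_size l)).
rewrite bigA_distr_bigA /=; apply: eq_bigr => J _.
by rewrite -big_split.
Qed.

(** Conjugation inverts numbers of modulus 1, so the monomials of exponents J and K combine into the
    frequency J - K. *)
Lemma kernel_sumE :
  (\sum_i \prod_l normc (Q l).[v i l] ^+ 2)%:C%C =
  \sum_J \sum_K w J * conjc (w K) * exp_sum (freq (diff_freq J K)).
Proof.
rewrite rmorph_sum /=.
transitivity (\sum_i \sum_J \sum_K w J * conjc (w K) *
    \prod_l v i l ^ freq (diff_freq J K) l).
  apply: eq_bigr => i _; rewrite rmorph_prod /=.
  under eq_bigr => l _ do rewrite sqr_normcE.
  rewrite big_split /= -rmorph_prod prod_horner rmorph_sum /= big_distrlr /=.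
  apply: eq_bigr => J _; apply: eq_bigr => K _.
  rewrite rmorphM /= mulrACA; congr (_ * _); rewrite rmorph_prod -big_split /=.
  apply: eq_bigr => l _; rewrite freq_diff rmorphXn /= conjc_normc1 //.
  by rewrite expfzDr ?normc1_neq0 // exprVn exprnN.
rewrite exchange_big /=; apply: eq_bigr => J _.
rewrite exchange_big /=; apply: eq_bigr => K _.
by rewrite -mulr_sumr.
Qed.

Lemma exp_sum_diag J : exp_sum (freq (@diff_freq n J J)) = k%:R.
Proof.
rewrite /exp_sum -[RHS](@mulr_natl _ 1) mulr1 -[in RHS](card_ord k) -sumr_const.
by apply: eq_bigr => i _; rewrite big1 // => l _; rewrite freq_diff subrr expr0z.
Qed.

Lemma sum_sqr_weight : \sum_J normc (w J) ^+ 2 = \prod_l coef_energy n (Q l).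
Proof.
rewrite bigA_distr_bigA /=; apply: eq_bigr => J _.
by rewrite normc_prod prodrXl.
Qed.

(* Schur's test for the quadratic form of [kernel_sumE]. *)
Lemma kernel_sum_close :
  `|\sum_i \prod_l normc (Q l).[v i l] ^+ 2
      - k%:R * \prod_l coef_energy n (Q l)|
   <= \prod_l coef_energy n (Q l) * exp_sum_l1 n.
Proof.
rewrite -normc_real rmorphB rmorphM -sum_sqr_weight.
rewrite [X in normc (X - _)]kernel_sumE rmorph_nat rmorph_sum mulr_sumr -sumrB /=.
(* The diagonal K = J has frequency 0 and yields exactly the main term. *)
have E J : \sum_K w J * conjc (w K) * exp_sum (freq (diff_freq J K))
    - k%:R * ((normc (w J)) ^+ 2)%:C%C
  = \sum_(K | K != J) w J * conjc (w K) * exp_sum (freq (diff_freq J K)).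
  by rewrite (bigD1 J) //= exp_sum_diag sqr_normcE; ring.
under eq_bigr => J _ do rewrite E.
apply: le_trans (normc_sum _ _ _) _.
pose W J K := normc (exp_sum (freq (@diff_freq n J K))).
apply: (@le_trans _ _ (\sum_J \sum_(K | K != J) normc (w J) * normc (w K) * W J K)).
  apply: ler_sum => J _; apply: le_trans (normc_sum _ _ _) _.
  by apply: ler_sum => K _; rewrite !normcM normc_conj.
apply: schur_test => [J K|J|J]; first exact: normc_ge0.
- apply: (@ler_sum_inj R _ _ (fun K => K != J) (@freq_nz n) (diff_freq J)
    (fun d => normc (exp_sum (freq d)))).
  + exact: diff_freq_injr.
  + by move=> K; rewrite eq_sym => /diff_freq_nz.
  + by move=> d; exact: normc_ge0.
- apply: (@ler_sum_inj R _ _ (fun K => K != J) (@freq_nz n)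
    (fun K => diff_freq K J) (fun d => normc (exp_sum (freq d)))).
  + exact: diff_freq_injl.
  + by move=> K /diff_freq_nz.
  + by move=> d; exact: normc_ge0.
Qed.

End Kernel.
End ExpSum.

(** * A kernel detecting empty boxes *)

Section Detector.
Variable R : rcfType.

Definition dirichlet h : {poly R[i]} := \poly_(a < h) 1.
(** On the unit circle D(z)^2 = z^(h-1) |D(z)|^2, so this is [h] times the Fejér kernel up to a
    factor of modulus 1. *)
Definition fejer h : {poly R[i]} := dirichlet h * dirichlet h.
Definition fejer_diff h : {poly R[i]} := (1 - 'X) * fejer h.

(** Telescoping of 1 - X against the Dirichlet sum; the coefficients are then [h] times 1 followed
    by [h] times -1. *)
Lemma fejer_diffE h : fejer_diff h = dirichlet h - 'X^h * dirichlet h.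
Proof.
rewrite /fejer_diff /fejer mulrA.
have -> : (1 - 'X) * dirichlet h = 1 - 'X^h.
  rewrite -opprB -[1 - 'X^h]opprB subrX1 mulNr /dirichlet poly_def.
  by congr (- (_ * _)); apply: eq_bigr => i _; rewrite scale1r.
by rewrite mulrBl mul1r.
Qed.

Lemma coef_fejer_diff h j : (fejer_diff h)`_j =
  if (j < h)%N then 1 else if (j < h + h)%N then - 1 else 0.
Proof.
rewrite fejer_diffE coefB coefXnM /dirichlet !coef_poly.
case: ltnP => hj; first by rewrite subr0.
by rewrite sub0r ltn_subLR //; case: ifP => _; rewrite ?oppr0.
Qed.

Lemma horner_fejer_diff h z : (fejer_diff h).[z] = (1 - z) * (fejer h).[z].
Proof. by rewrite [LHS]hornerM !hornerE. Qed.

Lemma size_fejer_diff h : (size (fejer_diff h) <= h + h)%N.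
Proof. by apply/leq_sizeP => j hj; rewrite coef_fejer_diff !ifF //; lia. Qed.

Lemma size_fejer h : (size (fejer h) <= h + h)%N.
Proof.
apply: leq_trans (size_polyMleq _ _) _; apply: leq_trans (leq_pred _) _.
by apply: leq_add; exact: size_poly.
Qed.

Lemma energy_fejer_diff h : coef_energy (h + h) (fejer_diff h) = (h + h)%:R.
Proof.
rewrite -[RHS](@mulr_natl _ 1) mulr1 -[in RHS](card_ord (h + h)) -sumr_const.
apply: eq_bigr => j _; rewrite coef_fejer_diff ltn_ord.
by case: ifP => _; rewrite ?normcN normc1 expr1n.
Qed.

(** The coefficients sum to D(1)^2 = h^2 and there are at most 2h of them, so Cauchy-Schwarz gives
    h^4 / (2h). *)
Lemma energy_fejer h : (0 < h)%N ->
  h%:R ^+ 3 / 2 <= coef_energy (h + h) (fejer h) :> R.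
Proof.
move=> h0; have h0' : 0 < h%:R :> R by rewrite ltr0n.
have H1 : h%:R ^+ 2 <= \sum_(j < h + h) normc (fejer h)`_j :> R.
  apply: le_trans (normc_sum _ _ _).
  have -> : \sum_(j < h + h) (fejer h)`_j = (h%:R ^+ 2 : R)%:C%C.
    transitivity ((fejer h).[1]).
      rewrite (horner_coef_wide _ (size_fejer h)).
      by apply: eq_bigr => j _; rewrite expr1n mulr1.
    rewrite hornerM /dirichlet horner_poly -expr2 rmorphXn rmorph_nat; congr (_ ^+ 2).
    under eq_bigr => i _ do rewrite expr1n mulr1.
    by rewrite sumr_const card_ord.
  by rewrite normc_real ger0_norm ?exprn_ge0 ?ler0n.
have := sqr_sum_le predT (fun j : 'I_(h + h) => normc (fejer h)`_j).
rewrite -/(coef_energy (h + h) (fejer h)) cardT size_enum_ord natrD.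
set s := \sum_(j | _) _ in H1 *; move=> H2.
have H3 : (h%:R ^+ 2) ^+ 2 <= s ^+ 2 :> R.
  by rewrite ler_sqr ?nnegrE ?sqr_ge0 // (le_trans _ H1) ?sqr_ge0.
rewrite -(ler_pM2l h0') -(ler_pM2l (ltr0n R 2)); nra.
Qed.

Variables (L k : nat) (v : 'I_k -> 'I_L -> R[i]).
Hypothesis v_norm : forall i l, normc (v i l) = 1.
Hypothesis L_gt0 : (0 < L)%N.

(* Each point has a coordinate far from 1, where the factor |1 - z|^2 turns the
   kernel [fejer] into [fejer_diff], of much smaller mean. *)
Lemma far_points_exp_sum (h : nat) (s : R) :
  (0 < h)%N -> 0 < s -> 8 * L%:R <= s * h%:R ^+ 2 ->
  (forall i, exists l, s <= normc (1 - v i l) ^+ 2) ->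
  k%:R <= 3 * exp_sum_l1 v (h + h).
Proof.
move=> h0 s0 hs far; set S := exp_sum_l1 _ _.
pose K : R := coef_energy (h + h) (fejer h).
pose Q (l0 l : 'I_L) := if l == l0 then fejer_diff h else fejer h.
have K_ge := energy_fejer h0; rewrite -/K in K_ge.
have h0' : 0 < h%:R :> R by rewrite ltr0n.
have K0 : 0 < K by apply: lt_le_trans K_ge; rewrite divr_gt0 ?exprn_gt0.
have P_ge := kernel_sum_close v_norm (fun l : 'I_L => size_fejer h).
have Q_size l0 l : (size (Q l0 l) <= h + h)%N.
  by rewrite /Q; case: eqP => _; [exact: size_fejer_diff | exact: size_fejer].
have M_le l0 := kernel_sum_close v_norm (Q_size l0).
have EQ l0 : \prod_l coef_energy (h + h) (Q l0 l) = (h + h)%:R * K ^+ L.-1.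
  rewrite (bigD1 l0) //= /Q eqxx energy_fejer_diff; congr (_ * _).
  rewrite (eq_bigr (fun=> K)); last by move=> l /negPf ->.
  by rewrite prodr_const cardC1 card_ord.
set P := \sum_i _ in P_ge.
(* For each [i] the term at its own far coordinate suffices; the other [l0] contribute nonnegative
   terms. *)
have sP : s * P <= \sum_l0 \sum_i \prod_l normc (Q l0 l).[v i l] ^+ 2.
  rewrite exchange_big /= mulr_sumr; apply: ler_sum => i _.
  have [l0 far0] := far i; rewrite [leRHS](bigD1 l0) //=; apply: ler_wpDr.
    by apply: sumr_ge0 => l _; apply: prodr_ge0 => *; exact: sqr_ge0.
  rewrite (bigD1 l0) //= [leRHS](bigD1 l0) //= {1}/Q eqxx mulrA.
  rewrite [X in _ <= _ * X](eq_bigr (fun l => normc (fejer h).[v i l] ^+ 2)).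
    rewrite ler_wpM2r //; first by apply: prodr_ge0 => *; exact: sqr_ge0.
    by rewrite horner_fejer_diff normcM exprMn ler_wpM2r ?sqr_ge0.
  by move=> l /negPf lE; rewrite /Q lE.
have {}sP : s * P <= L%:R * ((h + h)%:R * K ^+ L.-1 * (k%:R + S)).
  apply: le_trans sP _.
  rewrite mulr_natl -[X in _ *+ X](card_ord L) -sumr_const.
  apply: ler_sum => l0 _; have := M_le l0; rewrite EQ -/S ler_norml lerBlDr.
  rewrite mulrDr (mulrC k%:R) [X in _ && (_ <= X)]addrC.
  by case/andP.
have {}P_ge : K ^+ L.-1 * (K * (k%:R - S)) <= P.
  move: P_ge; rewrite prodr_const card_ord -/K -/S -{1 2}(prednK L_gt0) exprS.
  by rewrite ler_norml => /andP[+ _]; lra.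
have main : s * (K * (k%:R - S)) <= L%:R * (h + h)%:R * (k%:R + S).
  have K1 : 0 < K ^+ L.-1 by rewrite exprn_gt0.
  rewrite -(ler_pM2l K1); move: (ler_wpM2l (ltW s0) P_ge) sP; lra.
have S0 : 0 <= S by exact: exp_sum_l1_ge0.
(* The 8 enters here: K >= h^3 / 2 gives s K >= 4 L h. Then [main] yields k - S <= (k + S) / 2, that
   is k <= 3 S. *)
have J_le : L%:R * (h + h)%:R <= s * K / 2.
  rewrite natrD; have : s * (h%:R ^+ 3 / 2) <= s * K by rewrite ler_pM2l.
  have : 8 * L%:R * h%:R <= s * h%:R ^+ 2 * h%:R by rewrite ler_pM2r.
  rewrite exprSr; lra.
have sK : 0 < s * K by rewrite mulr_gt0.
have : L%:R * (h + h)%:R * (k%:R + S) <= s * K / 2 * (k%:R + S).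
  by apply: ler_wpM2r => //; rewrite addr_ge0.
move=> H; rewrite -(ler_pM2l sK); lra.
Qed.

Definition exp_sum_l2 n : R :=
  \sum_(d | @freq_nz L n d) normc (exp_sum v (freq d)) ^+ 2.

(** Cauchy-Schwarz over the at most (4h)^L frequencies; the 9 is the square of the 3 in
    [far_points_exp_sum]. *)
Lemma far_points_second_moment (h : nat) (s : R) :
  (0 < h)%N -> 0 < s -> 8 * L%:R <= s * h%:R ^+ 2 ->
  (forall i, exists l, s <= normc (1 - v i l) ^+ 2) ->
  k%:R ^+ 2 <= 9 * (4 * h%:R) ^+ L * exp_sum_l2 (h + h).
Proof.
move=> h0 s0 hs far; have le3 := far_points_exp_sum h0 s0 hs far.
have S0 := exp_sum_l1_ge0 v (h + h).
have le9 : k%:R ^+ 2 <= 9 * exp_sum_l1 v (h + h) ^+ 2.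
  have := ler0n R k; nra.
apply: le_trans le9 _; rewrite -mulrA ler_pM2l //.
apply: le_trans (sqr_sum_le _ _) _; apply: ler_wpM2r.
  by apply: sumr_ge0 => *; exact: sqr_ge0.
apply: le_trans (_ : (#|{: {ffun 'I_L -> 'I_((h + h) + (h + h))}}|)%:R <= _).
  by rewrite ler_nat max_card.
rewrite card_ffun !card_ord natrX !natrD lerXn2r ?nnegrE //; have := ler0n R h; lra.
Qed.

End Detector.

(** * The mean over the matrices *)

(** A field has at most [e] roots of X^e - 1, so each of the [N] coordinates takes at most [e]
    values. *)
Lemma card_unity_tuples (F : fieldType) (I : finType) (A : {pred I}) (N e : nat)
    (f : I -> 'I_N -> F) :
  (0 < e)%N -> {in A &, forall i i', f i =1 f i' -> i = i'} ->
  (forall i j, i \in A -> f i j ^+ e = 1) -> (#|A| <= e ^ N)%N.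
Proof.
move=> e0 f_inj f_unity.
pose rs := undup [seq f p.1 p.2 | p <- [seq p <- enum [set: I * 'I_N] | p.1 \in A]].
have mem_rs i j : i \in A -> f i j \in rs.
  move=> iA; rewrite mem_undup; apply/mapP; exists (i, j) => //.
  by rewrite mem_filter iA mem_enum finset.in_setT.
have rs_le : (size rs <= e)%N.
  apply: max_unity_roots (undup_uniq _) => //; apply/allP => z.
  rewrite mem_undup => /mapP[p]; rewrite mem_filter => /andP[pA _] ->.
  by apply/unity_rootP; exact: f_unity.
(* The form [e.-1.+1] of [e] provides the nonempty ordinal type that [inord] needs. *)
pose g i : {ffun 'I_N -> 'I_e.-1.+1} := [ffun j => inord (index (f i j) rs)].
have g_inj : {in A &, injective g}.
  move=> i i' iA iA' /ffunP E; apply: f_inj => // j.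
  have := congr1 val (E j); rewrite !ffunE /= !inordK.
  - exact: (index_inj 0 (mem_rs _ _ iA) (mem_rs _ _ iA')).
  - by rewrite prednK // (leq_trans _ rs_le) // index_mem mem_rs.
  - by rewrite prednK // (leq_trans _ rs_le) // index_mem mem_rs.
rewrite -(card_in_imset g_inj); apply: leq_trans (max_card _) _.
by rewrite card_ffun !card_ord prednK.
Qed.

(** Multiplied by 1 - g the sum telescopes to g - g^(H+1); the bound is uniform in [H]. *)
Lemma geometric_sum_bound (R : rcfType) (g : R[i]) (H : nat) :
  normc g = 1 -> g != 1 ->
  normc (\sum_(t < H) g ^+ t.+1) <= 2 / normc (1 - g).
Proof.
move=> g1 gN1.
have d0 : 0 < normc (1 - g).
  rewrite lt_neqAle normc_ge0 andbT eq_sym; apply: contra gN1 => /eqP/eq0_normc/eqP.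
  by rewrite subr_eq0 eq_sym.
rewrite ler_pdivlMr // mulrC -normcM.
under eq_bigr => t _ do rewrite exprS.
rewrite -mulr_sumr mulrCA -opprB mulNr -subrX1 normcM g1 mul1r normcN.
by apply: le_trans (le_normcD _ _) _; rewrite normcN normcX g1 expr1n normc1; lra.
Qed.

Lemma geometric_sum_trivial (R : rcfType) (g : R[i]) (H : nat) :
  normc g = 1 -> normc (\sum_(t < H) g ^+ t.+1) <= H%:R.
Proof.
move=> g1; apply: le_trans (normc_sum _ _ _) _.
rewrite -[leRHS](@mulr_natl _ 1) mulr1 -[in leRHS](card_ord H) -sumr_const.
by apply: ler_sum => t _; rewrite normcX g1 expr1n.
Qed.

Section SecondMoment.
Variables (R : rcfType) (L N k : nat) (c : 'I_k -> 'I_N -> R[i]).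
Hypothesis c_norm : forall i j, normc (c i j) = 1.
Hypothesis c_inj : forall i i', c i =1 c i' -> i = i'.
Hypotheses (L_gt0 : (0 < L)%N) (N_gt0 : (0 < N)%N).

(* [T] encodes the matrix with entries [(T p).+1]. *)
Definition dilate H (T : {ffun 'I_L * 'I_N -> 'I_H}) (i : 'I_k) (l : 'I_L) : R[i] :=
  \prod_j c i j ^+ (T (l, j)).+1.

Lemma dilate_norm H (T : {ffun 'I_L * 'I_N -> 'I_H}) i l : normc (dilate T i l) = 1.
Proof. by rewrite normc_prod big1 // => j _; rewrite normcX c_norm expr1n. Qed.

Section Frequency.
Variable m : 'I_L -> int.

Let g i i' (p : 'I_L * 'I_N) : R[i] := (c i p.2 / c i' p.2) ^ m p.1.

Lemma ratio_norm i i' p : normc (g i i' p) = 1.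
Proof. by rewrite normcXz normcM normcV !c_norm invr1 mulr1 exp1rz. Qed.

Lemma prod_dilate H (T : {ffun 'I_L * 'I_N -> 'I_H}) i :
  \prod_l dilate T i l ^ m l = \prod_p (c i p.2 ^ m p.1) ^+ (T p).+1.
Proof.
transitivity (\prod_l \prod_j (c i j ^ m l) ^+ (T (l, j)).+1); last first.
  by rewrite pair_bigA; apply: eq_bigr => -[].
apply: eq_bigr => l _.
rewrite /dilate (big_morph (fun x : R[i] => x ^ m l) (fun x y => expfzMl x y _)
  (exp1rz _ _)).
by apply: eq_bigr => j _; rewrite !exprnP exprzAC.
Qed.

Lemma sqr_exp_sum_dilate H (T : {ffun 'I_L * 'I_N -> 'I_H}) :
  (normc (exp_sum (dilate T) m) ^+ 2)%:C%C =
  \sum_i \sum_i' \prod_p g i i' p ^+ (T p).+1.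
Proof.
rewrite sqr_normcE /exp_sum rmorph_sum /= big_distrlr /=.
apply: eq_bigr => i _; apply: eq_bigr => i' _.
rewrite conjc_normc1; last first.
  by rewrite normc_prod big1 // => l _; rewrite normcXz dilate_norm exp1rz.
rewrite !prod_dilate -prodfV -big_split; apply: eq_bigr => p _ /=.
by rewrite /g expfzMl exprMn -exprVn invr_expz exprz_inv.
Qed.

(** The entries of [T] vary independently, so the sum over [T] factors into geometric sums. *)
Lemma mean_sqr_exp_sum H :
  (\sum_(T : {ffun 'I_L * 'I_N -> 'I_H}) normc (exp_sum (dilate T) m) ^+ 2)%:C%C =
  \sum_i \sum_i' \prod_p \sum_(t < H) g i i' p ^+ t.+1.
Proof.
rewrite rmorph_sum /=; under eq_bigr => T _ do rewrite sqr_exp_sum_dilate.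
rewrite exchange_big /=; apply: eq_bigr => i _.
rewrite exchange_big /=; apply: eq_bigr => i' _.
by rewrite bigA_distr_bigA.
Qed.

(** Additively, m_l (x_i - x_i') = 0 for all l: the pairs whose contribution does not cancel on
    averaging over [T]. *)
Let relation i i' := [forall p, g i i' p == 1].

(* For [g i i' p = 1] the summand is [2 / 0 = 0]. *)
Definition off_relation_bound : R :=
  \sum_i \sum_i' \sum_p 2 / normc (1 - g i i' p).

(** For an unrelated pair some ratio differs from 1; its geometric sum is bounded uniformly in [H],
    which saves one factor [H]. *)
Lemma prod_geometric_le H i i' :
  normc (\prod_p \sum_(t < H) g i i' p ^+ t.+1) <=
  (relation i i')%:R * H%:R ^+ (L * N) +
    (\sum_p 2 / normc (1 - g i i' p)) * H%:R ^+ (L * N).-1.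
Proof.
have pos p : 0 <= 2 / normc (1 - g i i' p) by rewrite divr_ge0 ?normc_ge0.
rewrite normc_prod; case: (boolP (relation i i')) => [rel|/forallPn[p0 gp0]].
  rewrite mul1r ler_wpDr //.
    by rewrite mulr_ge0 ?exprn_ge0 //; apply: sumr_ge0.
  rewrite -[X in _ ^+ (X * _)]card_ord -[X in _ ^+ (_ * X)]card_ord.
  rewrite -card_prod -prodr_const; apply: ler_prod => p _.
  by rewrite normc_ge0 geometric_sum_trivial ?ratio_norm.
rewrite mul0r add0r (bigD1 p0) //=; apply: ler_pM; rewrite ?normc_ge0 //.
- by apply: prodr_ge0 => *; exact: normc_ge0.
- rewrite (bigD1 p0) //=; apply: ler_wpDr; first by apply: sumr_ge0.
  by apply: geometric_sum_bound; rewrite ?ratio_norm.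
- rewrite -[X in _ ^+ (X * _).-1]card_ord -[X in _ ^+ (_ * X).-1]card_ord.
  rewrite -card_prod -(cardC1 p0) -prodr_const; apply: ler_prod => p _.
  by rewrite normc_ge0 geometric_sum_trivial ?ratio_norm.
Qed.

(** At an index l with m_l nonzero, the ratios c_ij / c_i'j are roots of unity of order dividing
    |m_l|, and they determine i' by [c_inj]. *)
Lemma card_relation (n : nat) i :
  (exists l, m l != 0) -> (forall l, `|m l| <= n)%N ->
  (#|[pred i' | relation i i']| <= n ^ N)%N.
Proof.
move=> [l ml] m_le; have e0 : (0 < `|m l|)%N by rewrite absz_gt0.
apply: leq_trans (_ : (`|m l| ^ N <= _)%N); last by rewrite leq_exp2r.
apply: (card_unity_tuples (f := fun i' j => c i j / c i' j)) => //.
  move=> i1 i2 _ _ E; apply: c_inj => j.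
  by have := E j => /mulfI; rewrite normc1_neq0 // => /(_ isT)/invr_inj.
move=> i' j; rewrite inE => /forallP/(_ (l, j))/eqP; rewrite /g /=.
case: (m l) => e /=; first by rewrite -exprnP.
by rewrite NegzE -exprnN => /(congr1 GRing.inv); rewrite invrK invr1.
Qed.

Lemma mean_sqr_exp_sum_le (n H : nat) :
  (exists l, m l != 0) -> (forall l, `|m l| <= n)%N ->
  \sum_(T : {ffun 'I_L * 'I_N -> 'I_H}) normc (exp_sum (dilate T) m) ^+ 2 <=
  k%:R * n%:R ^+ N * H%:R ^+ (L * N) + off_relation_bound * H%:R ^+ (L * N).-1.
Proof.
move=> m0 m_le; set s := leLHS.
have s0 : 0 <= s by apply: sumr_ge0 => *; exact: sqr_ge0.
rewrite -[s]ger0_norm // -normc_real /s mean_sqr_exp_sum.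
apply: le_trans (normc_sum _ _ _) _.
rewrite -mulrA (mulr_natl _ k) -[X in _ *+ X](card_ord k) -sumr_const.
rewrite /off_relation_bound mulr_suml -big_split; apply: ler_sum => i _ /=.
apply: le_trans (normc_sum _ _ _) _.
apply: le_trans (ler_sum _ (fun i' _ => prod_geometric_le H i i')) _.
rewrite big_split /= -!mulr_suml lerD2r; apply: ler_wpM2r; first exact: exprn_ge0.
rewrite -natr_sum -natrX ler_nat; apply: leq_trans (card_relation i m0 m_le).
by rewrite -sum1_card [leqRHS]big_mkcond /=; apply: leq_sum => i' _; rewrite inE.
Qed.

End Frequency.

(** [D] may depend on the points but not on [H], so its term is of lower order as [H] grows. *)
Lemma second_moment_le (n : nat) : exists D : R, forall H : nat,
  \sum_(T : {ffun 'I_L * 'I_N -> 'I_H}) exp_sum_l2 (dilate T) n <=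
  (n + n)%:R ^+ L * (k%:R * n%:R ^+ N) * H%:R ^+ (L * N) + D * H%:R ^+ (L * N).-1.
Proof.
exists (\sum_(d | @freq_nz L n d) off_relation_bound (freq d)) => H.
rewrite exchange_big /=.
apply: le_trans (_ : \sum_(d | @freq_nz L n d) (k%:R * n%:R ^+ N * H%:R ^+ (L * N)
   + off_relation_bound (freq d) * H%:R ^+ (L * N).-1) <= _).
  apply: ler_sum => d /existsP d0; apply: mean_sqr_exp_sum_le => // l.
  by rewrite /freq; have := ltn_ord (d l); lia.
rewrite big_split /= -[X in _ + X]mulr_suml lerD2r sumr_const -[leLHS]mulr_natl -!mulrA.
apply: ler_wpM2r; first by rewrite !mulr_ge0 ?exprn_ge0.
rewrite -natrX ler_nat; apply: leq_trans (max_card _) _.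
by rewrite card_ffun !card_ord.
Qed.

End SecondMoment.

(** * Pairs of coprime integers *)

(** Induction with 1/(x+1)^2 <= 1/x - 1/(x+1); the value 3/4 makes the case n = 0 an equality. *)
Lemma sum_inv_sqr_le (n : nat) :
  \sum_(2 <= d < n.+3) (d%:R ^- 2 : rat) <= 3 / 4 - n.+2%:R^-1.
Proof.
elim: n => [|n IH]; first by rewrite big_nat1; lra.
rewrite big_nat_recr //=; apply: le_trans (lerD IH (lexx _)) _.
rewrite -addrA lerD2l.
have n0 : 0 < n.+2%:R :> rat by rewrite ltr0n.
rewrite -[n.+3%:R]natr1; move: n.+2%:R n0 => x n0.
have x1 : 0 < x + 1 by lra.
have -> : - x^-1 + (x + 1) ^- 2 = - (x + 1)^-1 - (x * (x + 1) ^+ 2)^-1.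
  by field; rewrite !lt0r_neq0.
by rewrite gerBl invr_ge0 mulr_ge0 ?sqr_ge0 // ltW.
Qed.

Lemma sum_sqr_divn_le (H : nat) :
  (4 * \sum_(2 <= d < H.+1) (H %/ d) ^ 2 <= 3 * H ^ 2)%N.
Proof.
have [H2|H2] := ltnP H 2; first by rewrite big_geq.
rewrite -(ler_nat rat) natrM natr_sum (natrM _ 3) natrX.
have le1 : \sum_(2 <= d < H.+1) ((H %/ d) ^ 2)%:R <=
    (H%:R ^+ 2 : rat) * \sum_(2 <= d < H.+1) d%:R ^- 2.
  rewrite mulr_sumr; apply: ler_sum_nat => d /andP[d2 _].
  have d0 : 0 < d%:R :> rat by rewrite ltr0n; lia.
  rewrite natrX -exprVn -exprMn ler_sqr ?nnegrE ?divr_ge0 ?ler0n //.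
  by rewrite ler_pdivlMr // -natrM ler_nat leq_trunc_div.
have le2 : \sum_(2 <= d < H.+1) (d%:R ^- 2 : rat) <= 3 / 4.
  rewrite -(subnKC H2) add2n; apply: le_trans (sum_inv_sqr_le _) _.
  by rewrite gerBl invr_ge0.
have := ler_wpM2l (sqr_ge0 H%:R) le2; lra.
Qed.

Lemma sum_dvdn_succ (d H : nat) : (\sum_(t < H) (d %| t.+1) = H %/ d)%N.
Proof. by rewrite divn_count_dvd big_add1 big_mkord. Qed.

(** Union bound over the gcd d of the two entries, 2 <= d <= H: each d allows (H %/ d)^2 choices for
    the two entries and leaves the others free. *)
Lemma not_coprime_card (I : finType) (p1 p2 : I) (H : nat) : p1 != p2 ->
  (4 * #|[pred T : {ffun I -> 'I_H} | ~~ coprime (T p1).+1 (T p2).+1]|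
   <= 3 * H ^ #|I|)%N.
Proof.
move=> p12.
have cI : #|I| = #|[pred p | (p != p1) && (p != p2)]|.+2.
  rewrite (cardD1 p1) (cardD1 p2) !inE eq_sym p12; congr _.+2.
  by apply: eq_card => p; rewrite !inE andbT andbC.
(* The indicator that [d] divides both entries, written as a product over coordinates so that its
   sum over [T] factors. *)
pose w d p (t : 'I_H) : nat := if (p == p1) || (p == p2) then (d %| t.+1)%N else true.
have w1 d : (\sum_(T : {ffun I -> 'I_H}) \prod_p w d p (T p)
    = (H %/ d) ^ 2 * H ^ #|I|.-2)%N.
  rewrite -(bigA_distr_bigA (w d)) /= (bigD1 p1) //= (bigD1 p2) 1?eq_sym //=.
  rewrite /w !eqxx orbT sum_dvdn_succ mulnA cI /=; congr (_ * _)%N.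
  rewrite (eq_bigr (fun=> H)); first by rewrite prod_nat_const.
  by move=> p /andP[/negPf-> /negPf->]; rewrite sum1_card card_ord.
have le1 : (#|[pred T : {ffun I -> 'I_H} | ~~ coprime (T p1).+1 (T p2).+1]| <=
    \sum_(2 <= d < H.+1) \sum_(T : {ffun I -> 'I_H}) \prod_p w d p (T p))%N.
  rewrite exchange_big -sum1_card /= big_mkcond; apply: leq_sum => T _ /=.
  rewrite inE; case: ifP => // ncop.
  set e := gcdn (T p1).+1 (T p2).+1.
  have e_gt0 : (0 < e)%N by rewrite gcdn_gt0.
  have e_ge2 : (2 <= e)%N by move: ncop e_gt0; rewrite /coprime -/e; lia.
  have e_le : (e < H.+1)%N.
    by rewrite ltnS; apply: leq_trans (ltn_ord (T p1)); apply: dvdn_leq (dvdn_gcdl _ _).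
  rewrite (bigD1_seq e) ?mem_index_iota ?e_ge2 ?iota_uniq //=.
  rewrite big1 // => p _; rewrite /w; case: ifP => // /orP[]/eqP->.
    by rewrite dvdn_gcdl.
  by rewrite dvdn_gcdr.
move: le1; under eq_bigr => d _ do rewrite w1.
rewrite -big_distrl /= => le1; rewrite -(leq_pmul2l (isT : 0 < 4)%N) in le1.
apply: leq_trans le1 _; rewrite mulnA.
apply: leq_trans (leq_mul (sum_sqr_divn_le H) (leqnn _)) _.
by rewrite -mulnA -expnD cI.
Qed.

(** * The character of the torus *)

Section Character.
Variable R : realType.
Implicit Types (t : R) (u : torus R) (z : R[i]).

(** The character e(t) = exp(2 pi i t) of the real line. *)
Definition cis t : R[i] := Complex (cos (t * (pi *+ 2))) (sin (t * (pi *+ 2))).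

Lemma cisD t1 t2 : cis (t1 + t2) = cis t1 * cis t2.
Proof. by rewrite /cis mulrDl cosD sinD; simpc; congr Complex; ring. Qed.

Lemma cis0 : cis 0 = 1.
Proof. by rewrite /cis mul0r cos0 sin0. Qed.

Lemma cis1 : cis 1 = 1.
Proof. by rewrite /cis mul1r cos2pi sin2pi. Qed.

Lemma cis_norm t : normc (cis t) = 1.
Proof. by rewrite /= cos2Dsin2 sqrtr1. Qed.

Lemma cisN t : cis (- t) = (cis t)^-1.
Proof.
apply: (mulfI (normc1_neq0 (cis_norm t))).
by rewrite -cisD subrr cis0 divff // normc1_neq0 ?cis_norm.
Qed.

Lemma cisMn t m : cis (t *+ m) = cis t ^+ m.
Proof. by elim: m => [|m IH]; rewrite ?cis0 // mulrS exprS cisD IH. Qed.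

Lemma cis_int t : t \is a Num.int -> cis t = 1.
Proof.
move=> /intrP[[m|m] ->]; first by rewrite -pmulrn cisMn cis1 expr1n.
by rewrite NegzE mulrNz -pmulrn cisN cisMn cis1 expr1n invr1.
Qed.

Definition torus_char u : R[i] := cis (repr u).

Lemma torus_charE t : torus_char (torus_pi t) = cis t.
Proof.
rewrite /torus_char /torus_pi.
have : repr (\pi_(torus R) t)%qT - t \is a Num.int.
  by rewrite -[_ \is a _]/(_ \in Zsubgroup R) Quotient.idealrBE reprK.
move/cis_int; rewrite cisD cisN.
by move=> /(canRL (mulfVK (normc1_neq0 (cis_norm t)))) ->; rewrite mul1r.
Qed.

Lemma torus_piK u : torus_pi (repr u) = u.
Proof. exact: reprK. Qed.

Lemma torus_piD t1 t2 : torus_pi (t1 + t2) = torus_pi t1 + torus_pi t2.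
Proof. exact: (Quotient.pi_add (Zsubgroup R)). Qed.

Lemma torus_char_norm u : normc (torus_char u) = 1.
Proof. exact: cis_norm. Qed.

Lemma torus_charD u1 u2 : torus_char (u1 + u2) = torus_char u1 * torus_char u2.
Proof. by rewrite -[u1]torus_piK -[u2]torus_piK -torus_piD !torus_charE cisD. Qed.
Lemma torus_pi0 : torus_pi (0 : R) = 0.
Proof. by apply: (addrI (torus_pi 0)); rewrite -torus_piD !addr0. Qed.

Lemma torus_piN t : torus_pi (- t) = - torus_pi t.
Proof. by apply: (addrI (torus_pi t)); rewrite -torus_piD !subrr torus_pi0. Qed.

Lemma torus_pi_int t : t \is a Num.int -> torus_pi t = 0.
Proof.
move=> t_int; rewrite -torus_pi0; apply/eqP.
by rewrite -[_ == _]/(t == 0 %[mod torus R])%qT -Quotient.idealrBE subr0.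
Qed.

Lemma torus_char0 : torus_char (0 : torus R) = 1.
Proof. by rewrite -torus_pi0 torus_charE cis0. Qed.

Lemma torus_charN u : torus_char (- u) = (torus_char u)^-1.
Proof. by rewrite -[u]torus_piK -torus_piN !torus_charE cisN. Qed.

Lemma torus_charMn u m : torus_char (u *+ m) = torus_char u ^+ m.
Proof. by elim: m => [|m IH]; rewrite ?torus_char0 // mulrS exprS torus_charD IH. Qed.

Lemma torus_char_sum (I : Type) (r : seq I) (P : pred I) (F : I -> torus R) :
  torus_char (\sum_(i <- r | P i) F i) = \prod_(i <- r | P i) torus_char (F i).
Proof. exact: (big_morph _ torus_charD torus_char0). Qed.

(** The angle lies in [pi/2, pi], so the cosine is nonpositive in |1 - e(t)|^2 = 2 - 2 cos(2 pi
    t). *)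
Lemma cis_quarter t : 1 / 4 <= t <= 1 / 2 -> 2 <= normc (1 - cis t) ^+ 2.
Proof.
move=> /andP[t_ge t_le].
have cos_le0 : cos (t * (pi *+ 2)) <= 0.
  rewrite -[t * _](subrK (pi / 2)) cosDpihalf oppr_le0 sin_ge0_pi //.
  by have := pi_gt0 R; rewrite mulr2n => pi0; apply/andP; split; nra.
have := cos2Dsin2 (t * (pi *+ 2)).
rewrite /cis; simpc; rewrite /= sqr_sqrtr ?addr_ge0 ?sqr_ge0 //.
by move: cos_le0; set a := cos _; set b := sin _ => *; nra.
Qed.

Lemma cis_subr1_mul t m : normc (1 - cis (t *+ m)) <= m%:R * normc (1 - cis t).
Proof.
rewrite cisMn normcB subrX1 normcM normcB mulrC ler_wpM2r ?normc_ge0 //.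
apply: le_trans (normc_sum _ _ _) _.
rewrite -[leRHS](@mulr_natl _ 1) mulr1 -[in leRHS](card_ord m) -sumr_const.
by apply: ler_sum => i _; rewrite normcX cis_norm expr1n.
Qed.

(* Some multiple [m t] with [m <= 1 / (2 t)] lands in the arc [1/4, 1/2]. *)
Lemma cis_away t : 0 < t <= 1 / 2 -> 8 * t ^+ 2 <= normc (1 - cis t) ^+ 2.
Proof.
move=> /andP[t0 t_le].
pose m := Num.truncn (1 / (2 * t)).
have t2 : 0 < 2 * t by lra.
have [m_le m_gt] : m%:R <= 1 / (2 * t) /\ 1 / (2 * t) < m.+1%:R.
  by apply/andP; apply: truncn_itv; rewrite divr_ge0 // ltW.
move: m_le m_gt; rewrite ler_pdivlMr // ltr_pdivrMr // -natr1 => m_le m_gt.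
have m_ge1 : 1 <= m%:R :> R.
  by rewrite ler1n lt0n; apply/eqP => m0; move: m_gt; rewrite m0; lra.
have := @cis_quarter (t *+ m).
(* As m >= 1, maximality of [m] gives 1 < 2t(m + 1) <= 4tm. *)
have -> : 1 / 4 <= t *+ m <= 1 / 2 by rewrite -(mulr_natr t); apply/andP; split; nra.
move=> /(_ isT); have := cis_subr1_mul t m.
set a := normc _; set b := normc _ => ab two.
have a0 : 0 <= a by exact: normc_ge0.
have b0 : 0 <= b by exact: normc_ge0.
have two' : 2 <= (m%:R * b) ^+ 2.
  by apply: le_trans two _; rewrite ler_sqr ?nnegrE ?mulr_ge0.
have m1 : (m%:R * (2 * t)) ^+ 2 <= 1 by rewrite expr_le1 // mulr_ge0 //; lra.
have m2 : 0 < m%:R ^+ 2 :> R by rewrite exprn_gt0 //; lra.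
(* The constant 8 comes from 8 m^2 t^2 = 2 (2mt)^2 <= 2 <= (mb)^2. *)
rewrite -(ler_pM2l m2); apply: le_trans (_ : 2 <= _); first by move: m1; nra.
by rewrite -exprMn.
Qed.

(** The lift in [-1/2, 1/2), whose absolute value is the distance of [u] to 0. *)
Definition centered u : R := repr u - (Num.floor (repr u + 1 / 2))%:~R.

Lemma torus_pi_centered u : u = torus_pi (centered u).
Proof.
by rewrite /centered torus_piD torus_piN torus_piK torus_pi_int ?intr_int // subr0.
Qed.

Lemma centered_itv u : - (1 / 2) <= centered u < 1 / 2.
Proof.
have := floor_itv (repr u + 1 / 2); rewrite intrD mulr1z /centered.
by move=> /andP[h1 h2]; apply/andP; split; lra.
Qed.

Lemma norm_cis_subr1 t : normc (1 - cis `|t|) = normc (1 - cis t).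
Proof.
case: (ger0P t) => // _; rewrite cisN -conjc_normc1 ?cis_norm //.
have -> : 1 - conjc (cis t) = conjc (1 - cis t) by rewrite rmorphB rmorph1.
by rewrite normc_conj.
Qed.

Lemma centered_away u : 0 < `|centered u| ->
  8 * `|centered u| ^+ 2 <= normc (1 - torus_char u) ^+ 2.
Proof.
move=> t0; rewrite {2}[u]torus_pi_centered torus_charE -norm_cis_subr1.
apply: cis_away; rewrite t0 ler_norml.
by have /andP[-> /ltW->] := centered_itv u.
Qed.

Lemma torus_char_away (e : R) u : 0 < e ->
  (forall t, u = torus_pi t -> e <= `|t|) ->
  8 * e ^+ 2 <= normc (1 - torus_char u) ^+ 2.
Proof.
move=> e0 u_away; have et := u_away _ (torus_pi_centered u).
apply: le_trans (centered_away (lt_le_trans e0 et)).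
by rewrite ler_pM2l // ler_sqr ?nnegrE // ltW.
Qed.

(** By [centered_away], a difference with character value 1 has centred lift 0. *)
Lemma torus_char_inj : injective torus_char.
Proof.
move=> u1 u2 E; apply/eqP; rewrite -subr_eq0; set u := u1 - u2.
have u1E : torus_char u = 1.
  by rewrite torus_charD torus_charN E divff // normc1_neq0 // torus_char_norm.
have [t0|t0] := leP `|centered u| 0.
  move: t0; rewrite normr_le0 => /eqP t0.
  by rewrite [u]torus_pi_centered t0 torus_pi0.
have := centered_away t0; rewrite u1E subrr normc0 expr0n /=.
by have := exprn_gt0 2 t0; lra.
Qed.

End Character.

(** * Dense dilations *)

Lemma card_le_injection (U : Type) (X : set U) (k : nat) : (`I_k #<= X)%card ->
  exists x : 'I_k -> U, injective x /\ forall i, X (x i).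
Proof.
move=> /card_leP[f].
pose s (i : 'I_k) : set_type `I_k := SigSub (mem_set (ltn_ord i) : (i : nat) \in `I_k).
exists (fun i => val (f (s i))); split; last by move=> i; exact: set_valP.
move=> i j /val_inj fij; apply: ord_inj.
by have /(congr1 val) := inj (mem_set I) (mem_set I) fij.
Qed.

Section Density.
Variables (R : realType) (L N k : nat) (x : 'I_k -> 'cV[torus R]_N).
Hypothesis x_inj : injective x.
Hypotheses (L_gt0 : (0 < L)%N) (N_gt0 : (0 < N)%N).

Let c i j := torus_char (x i j 0).

Definition dilation_mx H (T : {ffun 'I_L * 'I_N -> 'I_H}) : 'M[int]_(L, N) :=
  \matrix_(l, j) (T (l, j)).+1%:Z.

Lemma torus_char_dilation H (T : {ffun 'I_L * 'I_N -> 'I_H}) i l :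
  torus_char (torus_mulmx (dilation_mx T) (x i) l 0) = dilate c T i l.
Proof.
rewrite mxE torus_char_sum; apply: eq_bigr => j _.
by rewrite mxE -torus_charMn.
Qed.

(** A common translation multiplies each exponential sum by a number of modulus 1, so boxes may be
    centred at 0. *)
Lemma exp_sum_l2_shift (v : 'I_k -> 'I_L -> R[i]) (z : 'I_L -> R[i]) n :
  (forall l, normc (z l) = 1) ->
  exp_sum_l2 (fun i l => v i l * z l) n = exp_sum_l2 v n.
Proof.
move=> z1; apply: eq_bigr => d _; congr (_ ^+ 2).
rewrite /exp_sum; under eq_bigr => i _.
  under eq_bigr => l _ do rewrite expfzMl.
  rewrite big_split /=.
  over.
rewrite -mulr_suml normcM normc_prod [X in _ * X]big1 ?mulr1 // => l _.
by rewrite normcXz z1 exp1rz.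
Qed.

(** If a box is missed, move its centre to 0: every point then has a coordinate at distance at least
    [e] from 0, and [far_points_second_moment] with s = 8 e^2 contradicts [small]. *)
Lemma small_exp_sum_dense (h : nat) (e : R) H (T : {ffun 'I_L * 'I_N -> 'I_H})
    (X : set 'cV[torus R]_N) :
  (0 < h)%N -> 0 < e -> L%:R <= (e * h%:R) ^+ 2 -> (forall i, X (x i)) ->
  9 * (4 * h%:R) ^+ L * exp_sum_l2 (dilate c T) (h + h) < k%:R ^+ 2 ->
  eps_dense e (torus_mulmx (dilation_mx T) @` X)%classic.
Proof.
move=> h0 e0 Lh Xx small B [a [b1 [b2 ->]]].
apply: contrapT => /set0P/negP/negPn/eqP empty.
pose z l := torus_char (- torus_pi (a l + e)).
pose v i l := dilate c T i l * z l.
have v_norm i l : normc (v i l) = 1.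
  rewrite normcM torus_char_norm dilate_norm ?mulr1 // => i' j.
  exact: torus_char_norm.
have : k%:R ^+ 2 <= 9 * (4 * h%:R) ^+ L * exp_sum_l2 v (h + h).
  apply: (@far_points_second_moment _ _ _ v v_norm L_gt0 h (8 * e ^+ 2)) => //.
  - by rewrite mulr_gt0 ?exprn_gt0.
  - by rewrite -mulrA -exprMn ler_pM2l.
  move=> i; apply: contrapT => near.
  have : (set0 : set 'cV[torus R]_L) (torus_mulmx (dilation_mx T) (x i)).
    rewrite -empty; split; first by exists (x i).
    move=> l; set y := torus_mulmx _ _ l 0.
    have yz : v i l = torus_char (y - torus_pi (a l + e)).
      by rewrite torus_charD /v -torus_char_dilation.
    apply: contrapT => far; apply: near; exists l; rewrite yz.
    apply: torus_char_away => // t yt; rewrite leNgt; apply/negP.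
    (* The strict bound |t| < e puts the lift in the open interval, whichever endpoints the box
       contains. *)
    rewrite ltr_norml => /andP[t1 t2]; apply: far; exists (a l + e + t).
      rewrite in_itv /=; apply/andP; split.
        by case: (b1 l) => /=; lra.
      by case: (b2 l) => /=; lra.
    by rewrite torus_piD -yt addrC subrK.
  by [].
rewrite exp_sum_l2_shift; last by move=> l; exact: torus_char_norm.
by move=> /(lt_le_trans small); rewrite ltxx.
Qed.

Definition small_exp_sum (h H : nat) : pred {ffun 'I_L * 'I_N -> 'I_H} :=
  [pred T | 9 * (4 * h%:R) ^+ L * exp_sum_l2 (dilate c T) (h + h) < k%:R ^+ 2].

(** Markov's inequality: with q = (4h)^L, r = (2h)^N and P = H^(LN), a bad [T] contributes at least
    k^2 / (9q) to a total of at most 2 q k r P, and k > 72 q^2 r. *)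
Lemma card_small_exp_sum (h : nat) : (0 < h)%N ->
  72 * (4 * h%:R) ^+ (2 * L) * (2 * h%:R) ^+ N < k%:R :> R ->
  exists2 H : nat, (0 < H)%N &
    (4 * #|[predC @small_exp_sum h H]| < H ^ (L * N))%N.
Proof.
move=> h0 k_big.
have c_norm i j : normc (c i j) = 1 by exact: torus_char_norm.
have c_inj i i' : c i =1 c i' -> i = i'.
  move=> cE; apply: x_inj; apply/matrixP => j l.
  by rewrite (ord1 l); apply: torus_char_inj; exact: cE.
have [D mean_le] := second_moment_le c_norm c_inj L_gt0 N_gt0 (h + h).
(* With H >= D the error term is at most H^(LN), hence at most the main term; this costs a factor
   2. *)
pose H := Num.bound `|D|; exists H.
  by rewrite -(ltr0n R); apply: le_lt_trans (archi_boundP (normr_ge0 D)).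
have H0 : 0 < H%:R :> R by apply: le_lt_trans (archi_boundP (normr_ge0 D)).
have D_le : D <= H%:R.
  by rewrite (le_trans (ler_norm _)) // ltW // archi_boundP.
have {mean_le} := mean_le H; set M := \sum_T _.
set q : R := (4 * h%:R) ^+ L; set r : R := (2 * h%:R) ^+ N.
have -> : ((h + h) + (h + h))%:R ^+ L = q :> R by rewrite !natrD; congr (_ ^+ _); lra.
have -> : (h + h)%:R ^+ N = r :> R by rewrite !natrD; congr (_ ^+ _); lra.
have h1 : 1 <= h%:R :> R by rewrite ler1n.
have q1 : 1 <= q by apply: exprn_ege1; lra.
have r1 : 1 <= r by apply: exprn_ege1; lra.
have {}k_big : 72 * (q ^+ 2 * r) < k%:R.
  by apply: le_lt_trans k_big; rewrite mulnC exprM -!mulrA.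
have q2 : 1 <= q ^+ 2 by apply: exprn_ege1.
have qr1 : 1 <= q ^+ 2 * r by apply: mulr_ege1.
have k1 : 1 <= k%:R :> R by lra.
set P := H%:R ^+ (L * N) => M_le.
have P0 : 0 < P by rewrite exprn_gt0.
have DP : D * H%:R ^+ (L * N).-1 <= P.
  have LN0 : (0 < L * N)%N by rewrite muln_gt0 L_gt0.
  by rewrite /P -(prednK LN0) exprS ler_wpM2r ?exprn_ge0 // ltW.
have {}M_le : M <= 2 * (q * (k%:R * r)) * P.
  have : 1 <= q * (k%:R * r) by rewrite !mulr_ege1.
  by nra.
have bad_le : #|[predC @small_exp_sum h H]|%:R * k%:R ^+ 2 <= 9 * q * M.
  rewrite mulr_natl -sumr_const /M mulr_sumr big_mkcond /=.
  apply: ler_sum => T _; rewrite inE /= -leNgt; case: ifP => // _.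
  rewrite !mulr_ge0 ?exprn_ge0 ?mulr_ge0 //.
  by apply: sumr_ge0 => *; exact: sqr_ge0.
rewrite -(ltr_nat R) natrM natrX -/P -(ltr_pM2r (_ : 0 < k%:R ^+ 2)); last first.
  by rewrite exprn_gt0 //; lra.
have M2 : 9 * q * M <= 9 * q * (2 * (q * (k%:R * r)) * P).
  by apply: ler_wpM2l => //; lra.
have kP : 0 < k%:R * P by rewrite mulr_gt0 //; lra.
have : 72 * (q ^+ 2 * r) * (k%:R * P) < k%:R * (k%:R * P) by rewrite ltr_pM2r.
rewrite !expr2; rewrite !expr2 in bad_le; nra.
Qed.

(** Fewer than 1/4 of the [T] are bad and at most 3/4 have two chosen entries not coprime, so some
    [T] avoids both. *)
Lemma dense_coprime_dilation (h : nat) (e : R) (X : set 'cV[torus R]_N) :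
  (0 < h)%N -> 0 < e -> L%:R <= (e * h%:R) ^+ 2 ->
  72 * (4 * h%:R) ^+ (2 * L) * (2 * h%:R) ^+ N < k%:R :> R ->
  (forall i, X (x i)) ->
  exists T : 'M[int]_(L, N),
    ((1 < L * N)%N -> relatively_prime_entries T) /\
    eps_dense e (torus_mulmx T @` X)%classic.
Proof.
move=> h0 e0 Lh k_big Xx.
have [H H0 few_bad] := card_small_exp_sum h0 k_big.
have [T good prim] : exists2 T, @small_exp_sum h H T &
    ((1 < L * N)%N -> relatively_prime_entries (dilation_mx T)).
  have [LN1|LN1] := leqP (L * N) 1.
    apply: contrapT => none.
    have : (#|{: {ffun 'I_L * 'I_N -> 'I_H}}| <= #|[predC @small_exp_sum h H]|)%N.
      apply: subset_leq_card; apply/fintype.subsetP => T _.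
      rewrite inE; apply/negP => good.
      by apply: none; exists T.
    by rewrite card_ffun card_prod !card_ord; lia.
  have : (1 < #|{: 'I_L * 'I_N}|)%N by rewrite card_prod !card_ord.
  move=> /card_gt1P[p1 [p2 [_ _ p12]]].
  have := not_coprime_card H p12; rewrite card_prod !card_ord.
  set ncop := [pred T | _] => few_ncop.
  apply: contrapT => none.
  have : (#|{: {ffun 'I_L * 'I_N -> 'I_H}}|
      <= #|[predU [predC @small_exp_sum h H] & ncop]|)%N.
    apply: subset_leq_card; apply/fintype.subsetP => T _; rewrite !inE.
    apply: contrapT => /negP; rewrite negb_or !negbK => /andP[good cop].
    apply: none; exists T => // _; apply/eqP; rewrite -dvdn1.
    have := cop; rewrite /coprime => /eqP <-.
    have dvd p : (\big[gcdn/0%N]_(l < L) \big[gcdn/0%N]_(j < N)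
        `|dilation_mx T l j|%N %| (T p).+1)%N.
      apply: (@biggcdn_inf _ p.1) => //; apply: (@biggcdn_inf _ p.2) => //.
      by rewrite mxE -surjective_pairing.
    by rewrite dvdn_gcd !dvd.
  rewrite card_ffun card_prod !card_ord.
  have := leq_addr #|[predI [predC @small_exp_sum h H] & ncop]|
                   #|[predU [predC @small_exp_sum h H] & ncop]|.
  rewrite cardUI; move: few_bad few_ncop.
  have arith a b d m :
      (4 * a < m -> 4 * b <= 3 * m -> d <= a + b -> m <= d -> False)%N by lia.
  exact: arith.
by exists (dilation_mx T); split => //; exact: small_exp_sum_dense good.
Qed.

End Density.

(** * Large [eps] and the choice of the parameters *)

(** A box of side above 1 covers the torus: each coordinate has a lift within 1/2 of the centre
    [a l + eps]. *)
Lemma large_eps_dense (R : realType) (L N : nat) (eps : R) (X : set 'cV[torus R]_N)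
    (T : 'M[int]_(L, N)) :
  1 / 2 < eps -> (X !=set0)%classic -> eps_dense eps (torus_mulmx T @` X)%classic.
Proof.
move=> eps_gt [x Xx] B [a [b1 [b2 ->]]]; exists (torus_mulmx T x).
split; first by exists x.
move=> l; set y := torus_mulmx _ _ l 0.
pose t := centered (y - torus_pi (a l + eps)).
have /andP[t_ge t_lt] := centered_itv (y - torus_pi (a l + eps)).
exists (a l + eps + t).
  rewrite in_itv /=; apply/andP; split.
    by case: (b1 l) => /=; rewrite /t; lra.
  by case: (b2 l) => /=; rewrite /t; lra.
by rewrite torus_piD -torus_pi_centered addrC subrK.
Qed.

Lemma relatively_prime_const1 (L N : nat) : (0 < L)%N -> (0 < N)%N ->
  relatively_prime_entries (const_mx 1 : 'M[int]_(L, N)).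
Proof.
case: L N => [//|L] [//|N] _ _; apply/eqP; rewrite -dvdn1.
apply: (@biggcdn_inf _ ord0) => //; apply: (@biggcdn_inf _ ord0) => //.
by rewrite mxE.
Qed.

Lemma double_succ_le_exp (L : nat) : (0 < L)%N -> (2 * L + 1 <= 2 ^ (3 * L).-1)%N.
Proof.
case: L => // L _; elim: L => // L IH.
have -> : ((3 * L.+2).-1 = (3 * L.+1).-1 + 3)%N by lia.
rewrite expnD; lia.
Qed.

(* The slack in the exponent [3 L N] absorbs the factor [(2 L + 1) ^ N], since
   [2 L + 1 <= 2 ^ (3 L - 1) <= u ^ (3 L - 1)]. *)
Lemma kernel_size_bound (R : realType) (L N : nat) (u n : R) :
  (0 < L)%N -> (0 < N)%N -> 2 <= u -> 0 <= n -> n <= (2 * L + 1)%:R * u ->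
  n ^+ (2 * L + N) <= (2 * L + 1)%:R ^+ (2 * L + 1) * u ^+ (3 * L * N).
Proof.
move=> L0 N0 u2 n0 n_le; set A := (2 * L + 1)%:R : R.
have A0 : 0 <= A by exact: ler0n.
have u0 : 0 <= u by lra.
have A_le : A <= u ^+ (3 * L).-1.
  apply: le_trans (_ : (2 ^ (3 * L).-1)%:R <= _).
    by rewrite ler_nat double_succ_le_exp.
  by rewrite natrX lerXn2r ?nnegrE.
apply: le_trans (_ : (A * u) ^+ (2 * L + N) <= _).
  by rewrite lerXn2r ?nnegrE // mulr_ge0.
rewrite exprMn.
(* A^(2L+1) goes into the constant; the remaining A^(N-1) is at most u^((3L-1)(N-1)), and the
   exponent of [u] totals 3LN - L + 1 <= 3LN. *)
have -> : (2 * L + N = (2 * L + 1) + N.-1)%N by lia.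
rewrite exprD -mulrA ler_wpM2l ?exprn_ge0 //.
apply: le_trans (_ : u ^+ (3 * L).-1 ^+ N.-1 * u ^+ (2 * L + 1 + N.-1) <= _).
  by rewrite ler_wpM2r ?exprn_ge0 // lerXn2r ?nnegrE ?exprn_ge0.
rewrite -exprM -exprD ler_weXn2l //; first lra.
by case: L N L0 N0 {n_le A A0 A_le} => [//|L] [//|N] _ _; lia.
Qed.

Local Open Scope classical_set_scope.

(* For L = N = 1 relative primality of the single entry would force T = 1 or
   T = -1, and the assertion would fail (take for X a short arc); no
   primality is therefore claimed for a 1 x 1 matrix. *)
Theorem theorem5p1 (R : realType) (L : nat) (hL : (0 < L)%N) :
  exists C : R, 0 < C /\
    forall N : nat, (0 < N)%N ->
    forall eps : R, 0 < eps ->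
    forall X : set 'cV[torus R]_N,
      card_at_least X (C * eps ^- (3 * L * N)) ->
      exists T : 'M[int]_(L, N),
        ((1 < L * N)%N -> relatively_prime_entries T) /\
        eps_dense eps (torus_mulmx T @` X).
Proof.
pose A : R := (2 * L + 1)%:R ^+ (2 * L + 1).
have A0 : 0 < A by rewrite exprn_gt0 // ltr0n addn1.
have L4 : 0 < 4 ^+ L :> R by rewrite exprn_gt0.
(* 72 is the constant of [card_small_exp_sum], raised to 73 for strictness; [A] comes from
   [kernel_size_bound]. *)
exists (73 * 4 ^+ L * A); split; first by rewrite !mulr_gt0.
move=> N N0 eps eps0 X [k k_ge /card_le_injection[x [x_inj Xx]]].
set U := eps ^- (3 * L * N) in k_ge.
have U0 : 0 < U by rewrite invr_gt0 exprn_gt0.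
have AU : 0 < 4 ^+ L * (A * U) by rewrite !mulr_gt0.
have [eps_gt|eps_le] := ltP (1 / 2) eps.
  exists (const_mx 1); split; first by move=> _; exact: relatively_prime_const1.
  apply: large_eps_dense => //.
  have k0 : (0 < k)%N by rewrite -(ltr0n R); lra.
  by exists (x (Ordinal k0)).
(* The least integer above L / eps: then (eps h)^2 >= L^2 >= L, while 1/eps >= 2 gives 2h <= (2L +
   1) / eps. *)
pose h := (Num.truncn (L%:R / eps)).+1.
have L1 : 1 <= L%:R :> R by rewrite ler1n.
have /andP[h_le h_gt] : h.-1%:R <= L%:R / eps < h%:R.
  by apply: truncn_itv; rewrite divr_ge0 // ltW.
have h_le' : h%:R <= L%:R / eps + 1 by rewrite -[h]/(h.-1.+1) -natr1 lerD2r.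
have u2 : 2 <= eps^-1.
  by rewrite -[2]invrK lef_pV2 ?posrE ?invr_gt0 //; lra.
apply: (@dense_coprime_dilation _ _ _ _ x x_inj hL N0 h) => //.
  move: h_gt; rewrite ltr_pdivrMr // mulrC => h_gt.
  by apply: le_trans (_ : L%:R ^+ 2 <= _); nra.
have n_le : 2 * h%:R <= (2 * L + 1)%:R * eps^-1 by rewrite natrD natrM; nra.
have := kernel_size_bound hL N0 u2 (_ : 0 <= 2 * h%:R) n_le.
rewrite mulr_ge0 // exprVn -/U -/A => /(_ isT) bound.
(* Writing 4h = 2(2h) turns the threshold into 72 * 4^L * (2h)^(2L+N), which explains the factor 4^L
   in the constant. *)
have -> : 4 * h%:R = 2 * (2 * h%:R) :> R by ring.
rewrite exprMn exprM -[2 ^+ 2]/(2 * 2) -natrM -!mulrA -exprD.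
have := ler_wpM2l (ltW L4) bound; lra.
Qed.
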